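(* Let $\varepsilon,\delta>0$. (1) There are constants $k\in\mathbb N$, $\eta>0$, depending only on $\delta$, such that for every countable abelian group $\Gamma$ and every $A\subseteq\Gamma$ with $d^{*}(A)\ge\delta$, the set $A+A-A-a$ contains a Bohr-$(k,\eta)$ set for some $a\in A$. (2) There are constants $k'\in\mathbb N$, $\eta'>0$, depending only on $\delta$ and $\varepsilon$, such that for every countable abelian group $\Gamma$ and every $A\subseteq\Gamma$ with $d^{*}(A)\ge\delta$, there is a set $A'\subseteq A$ satisfying $d^{*}(A\setminus A')<\varepsilon$ and such that $A+A-A-a'$ contains a Bohr-$(k',\eta')$ set for all $a'\in A'$. In particular, the constants $k,k',\eta,\eta'$ do not depend on $\Gamma$.
   Context: Let $\mathbb T=\mathbb R/\mathbb Z$; for $x\in\mathbb T$, $\|x\|$ is the distance from any real representative of $x$ to the nearest integer. For a countable abelian group $\Gamma$, $k\in\mathbb N$ and $\eta>0$, a Bohr-$(k,\eta)$ set in $\Gamma$ is a set of the form $\{\gamma\in\Gamma:\|\rho_i(\gamma)\|<\eta\text{ for }i=1,\dots,k\}$, where $\rho_1,\dots,\rho_k:\Gamma\to\mathbb T$ are homomorphisms (not necessarily distinct). For $A\subseteq\Gamma$, $A+A-A=\{a+b-c:a,b,c\in A\}$, and $A+A-A-a$ is its translate by $-a$. A Følner sequence for $\Gamma$ is a sequence $\mathbf\Phi=(\Phi_n)_{n\in\mathbb N}$ of finite (nonempty) subsets of $\Gamma$ such that $\lim_{n\to\infty}|\Phi_n\triangle(\Phi_n+\gamma)|/|\Phi_n|=0$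 for every $\gamma\in\Gamma$. Write $d_{\mathbf\Phi}(A)=\lim_{n\to\infty}|A\cap\Phi_n|/|\Phi_n|$ when the limit exists. The upper Banach density of $A$ is $d^{*}(A)=\sup\{d_{\mathbf\Phi}(A)\}$, the supremum being over Følner sequences $\mathbf\Phi$ for which the limit exists. *)

(* Defs.v *)
From HB Require Import structures.
From mathcomp Require Export all_boot all_order all_algebra.
From mathcomp Require Export finmap.
From mathcomp Require Export all_classical all_reals all_analysis.

Set Implicit Arguments.
Unset Strict Implicit.
Unset Printing Implicit Defensive.

Import Order.TTheory GRing.Theory Num.Theory.
Import numFieldNormedType.Exports.

Local Open Scope classical_set_scope.
Local Open Scope quotient_scope.
Local Open Scope ring_scope.

(* Only the predicate underlying the qualifier Num.int carries the zmodClosed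
   structure that the quotient R/Z needs. *)
Definition torus (R : realType) : zmodType :=
  {ideal_quot (Num.int_num_subdef : {pred R})}.

Definition dist_int (R : realType) (x : R) : R :=
  inf [set `|x - m%:~R| | m in [set: int]].

(* By tnorm_pi below, the choice of representative is irrelevant. *)
Definition tnorm (R : realType) (x : torus R) : R := dist_int (repr x : R).

Lemma torus_piP (R : realType) (x y : R) :
  reflect (\pi x = \pi y :> torus R) (x - y \is a Num.int).
Proof.
apply: (iffP idP) => [xy|/eqP].
  by apply/eqP; rewrite -Quotient.idealrBE.
by rewrite -Quotient.idealrBE.
Qed.

Lemma dist_intDz (R : realType) (x y : R) :
  x - y \is a Num.int -> dist_int x = dist_int y.
Proof.
move=> /intrP[n xyn]; have -> : x = y + n%:~R by rewrite -xyn addrC subrK.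
rewrite /dist_int; congr inf; apply/seteqP; split => _ [m _ <-] /=.
  by exists (m - n) => //; rewrite intrB opprB addrA.
by exists (m + n) => //; rewrite intrD opprD addrACA subrr addr0.
Qed.

Lemma tnorm_pi (R : realType) (x : R) : tnorm (\pi x : torus R) = dist_int x.
Proof. by apply: dist_intDz; apply/torus_piP; rewrite reprK. Qed.

Definition is_bohr (R : realType) (G : zmodType) (k : nat) (eta : R)
    (B : set G) : Prop :=
  exists rho : 'I_k -> {additive G -> torus R},
    B = [set g | forall i, tnorm (rho i g) < eta].

Definition contains_bohr (R : realType) (G : zmodType) (k : nat) (eta : R)
    (S : set G) : Prop :=
  exists B : set G, is_bohr k eta B /\ B `<=` S.

Definition sumdiff (G : zmodType) (A : set G) : set G :=
  [set x | exists a b c : G, [/\ A a, A b, A c & x = a + b - c]].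

Definition translate (G : zmodType) (S : set G) (g : G) : set G :=
  [set x + g | x in S].

Definition fsymdiff (G : choiceType) (E F : {fset G}) : {fset G} :=
  ((E `\` F) `|` (F `\` E))%fset.

Definition folner (R : realType) (G : zmodType) (Phi : nat -> {fset G}) : Prop :=
  (forall n, Phi n != fset0%fset) /\
  forall g : G,
    (#|` fsymdiff (Phi n) [fset (x + g)%R | x in Phi n]%fset|%:R / #|` Phi n|%:R : R)
      @[n --> \oo] --> (0 : R).

Definition has_density (R : realType) (G : zmodType) (Phi : nat -> {fset G})
    (A : set G) (d : R) : Prop :=
  (#|` [fset x in Phi n | x \in A]%fset|%:R / #|` Phi n|%:R : R) @[n --> \oo] --> d.

(* The set of densities lies in [0, 1] and is nonempty whenever G is
   countable, so [sup] does not take its default value there. *)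
Definition upper_banach_density (R : realType) (G : zmodType) (A : set G) : R :=
  sup [set d | exists Phi : nat -> {fset G}, folner R Phi /\ has_density Phi A d].

(* Main.v *)
From HB Require Import structures.
Require Import Defs.
From mathcomp Require Import all_boot all_order all_algebra.
From mathcomp Require Import all_classical all_reals all_analysis.
From mathcomp Require Import ring lra.

Set Implicit Arguments.
Unset Strict Implicit.
Unset Printing Implicit Defensive.

Import Order.TTheory GRing.Theory Num.Theory.
Import numFieldNormedType.Exports.

Local Open Scope classical_set_scope.
Local Open Scope ring_scope.

(** Part (2) is part (1) applied to an exceptional set: let [A'] be the set of the
    [a] in [A] for which [A + A - A - a] contains a Bohr set with the constants
    that part (1) gives for density [eps].  If [A \ A'] had density at least
    [eps], then part (1) would give a point [a] of [A \ A'] at which already the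
    smaller set [(A \ A') + (A \ A') - (A \ A') - a] contains such a Bohr set,
    and [a] would lie in [A'].

    For part (1), fix a Folner sequence [Phi_n] along which [A] has density more
    than [e = delta / 2], and let [phi g] be the density of [A] intersected with
    [A - g], taken along an ultrafilter.  The function [phi] is positive definite
    and [phi g > 0] forces [g] into [A - A].  Hence the convolution
    [H_n y = avg_(b in Phi_n) 1_A(b) phi (y - b)] is positive only at points of
    [A + A - A].  By the Cauchy-Schwarz inequality [1_A H_n] has mean more than
    [c = e ^ 4] on [Phi_n], so some [a] in [A] has [H_n a > c]; it remains to
    bound [H_n (a + x) - H_n a] for all [x] in a Bohr set whose rank and radius
    depend on [c] only.

    To this end the large atoms of the spectral measure of [phi] are removed one
    at a time: [phi = sum_(i < N) w_i p_i + r] with each [p_i] the real part of a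
    character, [w_i >= 0], [r] positive definite, and
    [avg_(a, b in Phi_n) r (a - b) ^ 2 < kappa] for most [n]
    ([finite_atoms_plus_small]).  Each step lowers the value at 0, which is at
    most 1, by [kappa], so about [1 / kappa] steps suffice.  Since [r] is positive
    definite, the Cauchy-Schwarz inequality turns the smallness of this average
    into a bound for the [r]-part of [H_n] that is uniform over the group
    ([favg_convolution_small]); the parts coming from the [p_i] vary little when
    every [p_i x] is close to 1 ([posdef_krein]).

    The existence of the characters is the crux ([atom_extraction]).  Instead of
    the theorems of Bochner and Wiener, the proof uses that characters are the
    extreme points of the normalized positive definite functions: a linear
    functional on these is maximized at an extreme point
    ([exists_cosine_correlated]), and the functional
    [q |-> avg_(a, b in Phi_n) psi (a - b) q (a - b)] takes at
    [psi / psi 0] a value at least [kappa] as long as [psi] is not small in the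
    sense above.  A limit of the maximizers for [n] tending to infinity is an
    atom of [psi] of mass at least [kappa].

    All functions are real.  The extreme points are then the functions with
    [p (x + g) + p (x - g) = 2 p x p g], called cosines here, and one has to
    recover from a cosine a homomorphism to R/Z ([cosine_sine],
    [cosine_torus]). *)

(** * Positive definite functions *)

Section PositiveDefinite.
Context {R : realType} {G : zmodType}.
Implicit Types (p q : G -> R) (z w : seq (R * G)) (t g : G).

(** The list [z] stands for the finitely supported signed measure that puts mass
    [x.1] at the point [x.2]. *)
Definition pairing z p : R := \sum_(x <- z) x.1 * p x.2.

(** The convolution of the measure [z] with its reflection. *)
Definition autocorr z : seq (R * G) :=
  [seq (x.1 * y.1, x.2 - y.2) | x <- z, y <- z].

(** Evenness is required separately because a quadratic form with real
    coefficients sees the even part of [p] only. *)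
Definition posdef p : Prop :=
  (forall g, p (- g) = p g) /\ forall z, 0 <= pairing (autocorr z) p.

(** If [p] is the matrix coefficient [<U_t v, v>] of a representation, this is the
    coefficient of the vector [sum_(x <- z) x.1 * U_(x.2) v]. *)
Definition smear z p : G -> R :=
  fun t => pairing (autocorr z) (fun u => p (t + u)).

Lemma autocorrE z p :
  pairing (autocorr z) p = \sum_(x <- z) \sum_(y <- z) x.1 * y.1 * p (x.2 - y.2).
Proof. by rewrite /pairing /autocorr big_allpairs_dep. Qed.

Lemma pairing1 c g p : pairing [:: (c, g)] p = c * p g.
Proof. by rewrite /pairing big_seq1. Qed.

Lemma pairingZ z (c : R) q : pairing z (fun t => c * q t) = c * pairing z q.
Proof.
by rewrite /pairing mulr_sumr; apply: eq_bigr => x _; rewrite mulrCA.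
Qed.

Lemma pairing_lin z (a b : R) p q :
  pairing z (fun t => a * p t + b * q t) = a * pairing z p + b * pairing z q.
Proof.
rewrite /pairing !mulr_sumr -big_split /=; apply: eq_bigr => x _.
by rewrite mulrDr !(mulrCA x.1).
Qed.

Lemma autocorr_cons c g z p : (forall h, p (- h) = p h) ->
  pairing (autocorr ((c, g) :: z)) p =
  c ^+ 2 * p 0 + 2 * c * (\sum_(x <- z) x.1 * p (g - x.2))
    + pairing (autocorr z) p.
Proof.
move=> pN; rewrite !autocorrE big_cons big_cons /= subrr.
under [in X in _ + X]eq_bigr do rewrite big_cons /=.
rewrite big_split /= !addrA; congr (_ + _); rewrite -addrA -expr2; congr (_ + _).
have -> : \sum_(x <- z) x.1 * c * p (x.2 - g) = \sum_(x <- z) c * x.1 * p (g - x.2).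
  by apply: eq_bigr => x _; rewrite (mulrC x.1) -(pN (g - _)) opprB.
rewrite mulr_sumr -big_split /=; apply: eq_bigr => x _; ring.
Qed.

Lemma posdef_ge0 p : posdef p -> 0 <= p 0.
Proof.
by case=> _ /(_ [:: (1, 0)]); rewrite autocorrE !big_seq1 /= subrr !mul1r.
Qed.

Lemma posdef_le p t : posdef p -> `|p t| <= p 0.
Proof.
case=> pN pp.
have := pp [:: (1, t); (1, 0)]; have := pp [:: (-1, t); (1, 0)].
rewrite !autocorr_cons // !big_cons !big_nil /= /autocorr /= /pairing !big_nil /= subr0.
by move=> ? ?; rewrite ler_norml; apply/andP; split; lra.
Qed.

Lemma posdef_lin (a b : R) p q : 0 <= a -> 0 <= b -> posdef p -> posdef q ->
  posdef (fun t => a * p t + b * q t).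
Proof.
move=> a0 b0 [pN pp] [qN qp]; split=> [g|z]; first by rewrite pN qN.
by rewrite pairing_lin addr_ge0// mulr_ge0.
Qed.

(** Evaluating the form of [smear z p] at [w] is evaluating the form of [p] at the
    convolution of [w] and [z]. *)
Lemma posdef_smear z p : posdef p -> posdef (smear z p).
Proof.
case=> pN pp; split=> [g|w].
  rewrite /smear !autocorrE exchange_big; apply: eq_bigr => x _; apply: eq_bigr => y _.
  by rewrite (mulrC x.1) -pN opprD opprK opprB.
have := pp [seq (u.1 * x.1, u.2 + x.2) | u <- w, x <- z].
rewrite !autocorrE big_allpairs_dep /=.
congr (_ <= _); apply: eq_bigr => u _.
rewrite -[RHS]/(\sum_(v <- w) _).
under eq_bigr do rewrite big_allpairs_dep /=.
rewrite exchange_big /=; apply: eq_bigr => v _.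
rewrite /smear autocorrE mulr_sumr; apply: eq_bigr => x _.
rewrite mulr_sumr; apply: eq_bigr => y _.
rewrite -[RHS]mulrA; rewrite addrACA -opprD; ring.
Qed.

Lemma smear0 z p : smear z p 0 = pairing (autocorr z) p.
Proof.
by apply: eq_bigr => x _; rewrite add0r.
Qed.

(** For [a <> 0] evaluate at the minimum [- b / a].  A linear function is bounded
    below only if it is constant, which settles [a = 0]; this case occurs for the
    positive definite function 0. *)
Lemma quad_ge0_discr (a b c : R) : (forall t : R, 0 <= t ^+ 2 * a + 2 * t * b + c) ->
  b ^+ 2 <= a * c.
Proof.
move=> H.
have a_ge0 : 0 <= a.
  rewrite leNgt; apply/negP => a_lt0.
  have c_ge0 : 0 <= c by have := H 0; rewrite expr0n/= !(mul0r, mulr0, add0r).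
  set s := 1 + c / - a.
  have sE : s * - a = c - a by rewrite /s; field; rewrite lt_eqF.
  have s1 : 1 <= s by rewrite lerDl divr_ge0// oppr_ge0 ltW.
  by have := H s; have := H (- s); nra.
move: a_ge0; rewrite le_eqVlt => /predU1P[a0|a_gt0]; last first.
  have := H (- b / a).
  have -> : (- b / a) ^+ 2 * a + 2 * (- b / a) * b + c = (a * c - b ^+ 2) / a.
    field; exact: lt0r_neq0.
  by rewrite pmulr_lge0 ?invr_gt0// subr_ge0.
have [b0|b0] := eqVneq b 0; first by rewrite b0 -a0 expr0n/= mul0r.
have := H (- (c + 1) / (2 * b)); rewrite -a0.
have -> : (- (c + 1) / (2 * b)) ^+ 2 * 0 + 2 * (- (c + 1) / (2 * b)) * b + c = - 1.
  by field.
by rewrite leNgt ltrN10.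
Qed.

(** The Cauchy-Schwarz inequality between [z] and a point mass at [g]: the form is
    nonnegative at [z] plus any multiple of that point mass. *)
Lemma posdef_CS z p g : posdef p ->
  (\sum_(x <- z) x.1 * p (g - x.2)) ^+ 2 <= p 0 * pairing (autocorr z) p.
Proof.
move=> [pN pp]; apply: quad_ge0_discr => t.
by rewrite -autocorr_cons.
Qed.

(** Krein's inequality: a positive definite function is almost invariant under
    every [x] at which it is close to its maximum. *)
Lemma posdef_krein p g x : posdef p ->
  (p (g + x) - p g) ^+ 2 <= 2 * p 0 * (p 0 - p x).
Proof.
move=> pp; have := posdef_CS [:: (1, - x); (-1, 0)] g pp.
have pN := proj1 pp.
rewrite !autocorr_cons // !big_cons !big_nil /= /autocorr /= /pairing.
rewrite !big_nil /= !subr0 opprK pN !addr0 mul1r mulN1r => h.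
by apply: (le_trans h); rewrite le_eqVlt; apply/orP; left; apply/eqP; ring.
Qed.

Lemma posdefZ (c : R) q : 0 <= c -> posdef q -> posdef (fun t => c * q t).
Proof.
move=> c0 qp; have := posdef_lin c0 (lexx 0) qp qp.
by under [fun t => _ + _]eq_fun do rewrite mul0r addr0.
Qed.

Lemma posdef_eq0 q t : posdef q -> q 0 = 0 -> q t = 0.
Proof.
by move=> qp q0; have := posdef_le t qp; rewrite q0 normr_le0 => /eqP.
Qed.

Lemma normalized_le p g : posdef p -> p 0 = 1 -> `|p g| <= 1.
Proof. by move=> pp p0; rewrite -p0; exact: posdef_le. Qed.

Lemma one_posdef : posdef (fun=> 1 : R).
Proof.
split => // z; rewrite autocorrE.
suff -> : \sum_(x <- z) \sum_(y <- z) x.1 * y.1 * 1 = (\sum_(x <- z) x.1) ^+ 2 :> R.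
  exact: sqr_ge0.
rewrite expr2 mulr_suml; apply: eq_bigr => x _.
by rewrite mulr_sumr; apply: eq_bigr => y _; rewrite mulr1.
Qed.

(** A bounded solution of d'Alembert's equation; [cosine_torus] shows that such a
    function is the real part of a character. *)
Definition cosine p : Prop :=
  [/\ posdef p, p 0 = 1 & forall x g, p (x + g) + p (x - g) = 2 * p x * p g].

Lemma cosine_le1 p t : cosine p -> `|p t| <= 1.
Proof. by case=> pp p0 _; rewrite -p0 posdef_le. Qed.

Lemma cosine_one : cosine (fun=> 1 : R).
Proof. by split => //; [exact: one_posdef|move=> _ _; lra]. Qed.

End PositiveDefinite.

(** * Limits along an ultrafilter and lexicographic maximizers *)

Section Ultralimit.
Context {R : realType} (U : set_system nat) {UU : UltraFilter U}.
Context (oo_U : \oo `<=` U).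
Implicit Types (f h : nat -> R) (a b : R).

Definition ulim f : R := lim (f @ U).

Lemma ultra_or (A : set nat) : U A \/ U (~` A).
Proof. exact: in_ultra_setVsetC. Qed.

(** For a set [B], one of the preimages of [B] and of its complement is in [U]; a
    proper filter containing [B] cannot contain the complement. *)
Lemma ultra_fmap (T : Type) (f : nat -> T) : UltraFilter (f @ U).
Proof.
split; first exact: fmap_proper_filter.
move=> H PH sub; apply/seteqP; split => // B HB.
case: (in_ultra_setVsetC (f @^-1` B) UU) => // UB.
have : H (B `&` ~` B) by apply: filterI => //; exact: sub.
by rewrite setICr => /filter_not_empty.
Qed.

(** A segment is compact, so every ultrafilter on it converges. *)
Lemma ulimP f (C : R) : (\forall n \near U, `|f n| <= C) -> f @ U --> ulim f.
Proof.
move=> fC; have := @segment_compact R (- C) C; rewrite compact_ultra.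
move=> /(_ (f @ U) (ultra_fmap f)) [].
  rewrite /nbhs /=; apply: filterS fC => n.
  by rewrite /= in_itv /= ler_norml.
move=> l [_ fl]; rewrite /ulim; suff -> : lim (f @ U) = l by exact: fl.
exact: cvg_lim.
Qed.

Lemma cvgU_le f h a b : f @ U --> a -> h @ U --> b ->
  (\forall n \near U, f n <= h n) -> a <= b.
Proof. by move=> fa hb; exact: (ler_cvg_to fa hb). Qed.

Lemma cvgU_unique f a b : f @ U --> a -> f @ U --> b -> a = b.
Proof. by move=> fa fb; exact: (cvg_unique _ fa fb). Qed.

Lemma cvgU f a : f @ \oo --> a -> f @ U --> a.
Proof. move=> fa; apply: cvg_trans fa => B; exact: oo_U. Qed.

Lemma cvgU_sum (I : Type) (s : seq I) (F : I -> nat -> R) (a : I -> R) :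
  (forall i, F i @ U --> a i) ->
  (fun n => \sum_(i <- s) F i n) @ U --> \sum_(i <- s) a i.
Proof.
move=> Fa; elim: s => [|x s IH].
  by rewrite big_nil; under eq_cvg do rewrite big_nil; exact: cvg_cst.
rewrite big_cons; under eq_cvg do rewrite big_cons.
exact: cvgD.
Qed.

Section Group.
Context {G : zmodType}.
Implicit Types (p q : G -> R) (z : seq (R * G)) (l : nat -> seq (R * G)).

Lemma cvgU_pairing (s : nat -> G -> R) p z : (forall g, s ^~ g @ U --> p g) ->
  (fun n => pairing z (s n)) @ U --> pairing z p.
Proof. by move=> sp; apply: cvgU_sum => x; exact: cvgMr. Qed.

Lemma cvgU_posdef (s : nat -> G -> R) p : (forall g, s ^~ g @ U --> p g) ->
  (forall n, posdef (s n)) -> posdef p.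
Proof.
move=> sp spd; split=> [g|z].
  apply: (cvgU_unique (sp (- g))); under eq_cvg do rewrite (proj1 (spd _)).
  exact: sp.
apply: (@cvgU_le (fun=> 0) _ _ _ (cvg_cst _) (cvgU_pairing sp)).
by apply: nearW => n; exact: (proj2 (spd n)).
Qed.

(** Compactness of the set of normalized positive definite functions for pointwise
    convergence. *)
Lemma normalized_ulim (s : nat -> G -> R) :
  (forall n, posdef (s n)) -> (forall n, s n 0 = 1) ->
  exists p, [/\ posdef p, p 0 = 1 & forall g, s ^~ g @ U --> p g].
Proof.
move=> spd s0; exists (fun g => ulim (s ^~ g)).
have sp g : s ^~ g @ U --> ulim (s ^~ g).
  by apply: (@ulimP _ 1); apply: nearW => n; exact: normalized_le.
split => //; first exact: cvgU_posdef sp spd.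
apply: (cvgU_unique (sp 0)); under eq_cvg do rewrite s0; exact: cvg_cst.
Qed.

Let K : set (G -> R) := [set p | posdef p /\ p 0 = 1].

(** The stages of a lexicographic maximization over the normalized positive
    definite functions.  A single functional may have many maximizers; once all
    ties are broken the maximizer is extreme. *)
Fixpoint lexmax_upto (l : nat -> seq (R * G)) (n : nat) : set (G -> R) :=
  if n is m.+1 then
    [set p | lexmax_upto l m p /\
             forall q, lexmax_upto l m q -> pairing (l m) q <= pairing (l m) p]
  else K.

Lemma lexmax_uptoS l m n : (m <= n)%N -> lexmax_upto l n `<=` lexmax_upto l m.
Proof.
move=> /subnK <-; elim: (n - m)%N => [//|k IH] p.
by rewrite addSn => -[/IH].
Qed.

Lemma lexmax_upto_closed l n (s : nat -> G -> R) p :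
  (forall g, s ^~ g @ U --> p g) -> (forall i, K (s i)) -> K p ->
  (\forall i \near U, lexmax_upto l n (s i)) -> lexmax_upto l n p.
Proof.
move=> sp sK Kp; elim: n => [//|n IH] near_s; split.
  by apply: IH; apply: filterS near_s => i [].
move=> q Kq.
apply: (@cvgU_le (fun=> pairing (l n) q) _ _ _ (cvg_cst _) (cvgU_pairing sp)).
by apply: filterS near_s => i [_]; exact.
Qed.

Lemma pairing_bound z p : K p -> pairing z p <= \sum_(x <- z) `|x.1|.
Proof.
move=> [pp p0]; apply: ler_sum => x _; apply: (le_trans (ler_norm _)).
by rewrite normrM ler_piMr// normalized_le.
Qed.

Lemma lexmax_upto_nonempty l n : lexmax_upto l n !=set0.
Proof.
elim: n => [|n [p0 Kp0]]; first by exists (fun=> 1); split => //; exact: one_posdef.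
pose S := [set pairing (l n) q | q in lexmax_upto l n].
have hS : has_sup S.
  split; first by exists (pairing (l n) p0), p0.
  exists (\sum_(x <- l n) `|x.1|) => _ [q Kq <-]; apply: pairing_bound.
  exact: (lexmax_uptoS (leq0n n) Kq).
have /choice[s sP] : forall i : nat, exists q, lexmax_upto l n q /\
    sup S - i.+1%:R^-1 < pairing (l n) q.
  move=> i; have i0 : 0 < i.+1%:R^-1 :> R by rewrite invr_gt0.
  have [_ [q Kq <-] ?] := sup_adherent i0 hS.
  by exists q.
have sK i : K (s i) by apply: (lexmax_uptoS (leq0n n)); exact: (proj1 (sP i)).
have [p [pp p1 sp]] := normalized_ulim (fun i => proj1 (sK i)) (fun i => proj2 (sK i)).
have Kp : lexmax_upto l n p.
  by apply: (lexmax_upto_closed sp sK) => //; apply: nearW => i; exact: (proj1 (sP i)).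
exists p; split => // q Kq.
apply: (@le_trans _ _ (sup S)).
  by apply: ub_le_sup => //; [exact: (proj2 hS)|exists q].
apply: (@cvgU_le (fun i : nat => sup S - i.+1%:R^-1) (fun i => pairing (l n) (s i))).
- rewrite -[X in _ --> X]subr0; apply: cvgB; first exact: cvg_cst.
  by apply: cvgU; exact: cvg_harmonic.
- exact: cvgU_pairing.
- by apply: nearW => i; rewrite ltW// (proj2 (sP i)).
Qed.

(** A diagonal choice from the nested compact sets [lexmax_upto l n] lies, in the
    limit, in all of them. *)
Lemma lexmax_exists (l : nat -> seq (R * G)) : exists p, [/\ posdef p, p 0 = 1 &
  forall n q, posdef q -> q 0 = 1 ->
    (forall m, (m < n)%N -> pairing (l m) q = pairing (l m) p) ->
    pairing (l n) q <= pairing (l n) p].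
Proof.
have /choice[s sP] := lexmax_upto_nonempty l.
have sK i : K (s i) by exact: (lexmax_uptoS (leq0n i) (sP i)).
have [p [pp p1 sp]] := normalized_ulim (fun i => proj1 (sK i)) (fun i => proj2 (sK i)).
have Kp n : lexmax_upto l n p.
  apply: (lexmax_upto_closed sp sK) => //.
  apply: oo_U; exists n => // i /= ni; exact: (lexmax_uptoS ni (sP i)).
exists p; split => // n q qp q0 qE.
suff : lexmax_upto l n q by exact: (proj2 (Kp n.+1)).
elim: n qE => [//|n IH] qE; split; first by apply: IH => m mn; apply: qE; exact: leqW.
by move=> r Kr; rewrite qE//; exact: (proj2 (Kp n.+1)).
Qed.

End Group.
End Ultralimit.

(** * Indecomposable positive definite functions *)

Section ExtremePoints.
Context {R : realType} {G : zmodType}.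
Implicit Types (p q : G -> R) (z : seq (R * G)) (l : nat -> seq (R * G)).

(** Extremality, in a form that avoids normalizing the summands. *)
Definition indecomposable p : Prop := forall q1 q2, posdef q1 -> posdef q2 ->
  (forall t, p t = q1 t + q2 t) -> forall t, q1 t = q1 0 * p t.

(** Let [p] be a convex combination of two normalized functions that agree with
    [p] at all functionals before [l n].  Neither of them exceeds [p] at [l n], so
    both agree with [p] there too.  Since the functionals separate points, both
    are [p]. *)
Lemma lexmax_indecomposable l p :
  (forall g, exists n, l n = [:: (1, g)]) -> p 0 = 1 ->
  (forall n q, posdef q -> q 0 = 1 ->
    (forall m, (m < n)%N -> pairing (l m) q = pairing (l m) p) ->
    pairing (l n) q <= pairing (l n) p) ->
  indecomposable p.
Proof.
move=> lsep p0 pmax q1 q2 q1p q2p pE t.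
have q10 := posdef_ge0 q1p; have q20 := posdef_ge0 q2p.
have [q1z|q1z] := eqVneq (q1 0) 0; first by rewrite q1z mul0r posdef_eq0.
have [q2z|q2z] := eqVneq (q2 0) 0.
  have q1E s : q1 s = p s by rewrite pE (posdef_eq0 s q2p q2z) addr0.
  by rewrite !q1E p0 mul1r.
pose r1 s := (q1 0)^-1 * q1 s; pose r2 s := (q2 0)^-1 * q2 s.
have r1p : posdef r1 by apply: posdefZ => //; rewrite invr_ge0.
have r2p : posdef r2 by apply: posdefZ => //; rewrite invr_ge0.
have r10 : r1 0 = 1 by rewrite /r1 mulVf.
have r20 : r2 0 = 1 by rewrite /r2 mulVf.
have pairE n : pairing (l n) p = q1 0 * pairing (l n) r1 + q2 0 * pairing (l n) r2.
  rewrite -pairing_lin; congr pairing; apply/funext => s.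
  by rewrite /r1 /r2 !mulVKf.
have q12 : q1 0 + q2 0 = 1 by rewrite -pE.
suff H n : pairing (l n) r1 = pairing (l n) p /\ pairing (l n) r2 = pairing (l n) p.
  have [n ln] := lsep t; have [] := H n; rewrite ln !pairing1 !mul1r => <- _.
  by rewrite /r1 mulVKf.
elim/ltn_ind: n => n IH.
have h1 := pmax n r1 r1p r10 (fun m mn => proj1 (IH m mn)).
have h2 := pmax n r2 r2p r20 (fun m mn => proj2 (IH m mn)).
have q10' : 0 < q1 0 by rewrite lt_neqAle eq_sym q1z.
have q20' : 0 < q2 0 by rewrite lt_neqAle eq_sym q2z.
move: (pairE n) h1 h2; move: (pairing _ p) (pairing _ r1) (pairing _ r2) => A B C.
move=> AE BA CA; have {}q12 : q2 0 = 1 - q1 0 by lra.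
move: AE q20'; rewrite q12 => AE ?.
by split; nra.
Qed.

(** The coefficients of the vectors [v + U_g v] and [v - U_g v] are positive
    definite and add up to a multiple of the coefficient of [v].  That each of
    them is a multiple of [p] is d'Alembert's equation. *)
Lemma indecomposable_cosine p : posdef p -> p 0 = 1 -> indecomposable p -> cosine p.
Proof.
move=> pp p0 pind; split => // x g.
pose q (e : R) t := 4^-1 * smear [:: (1, 0); (e, g)] p t.
have qp e : posdef (q e) by apply: posdefZ; [rewrite invr_ge0|exact: posdef_smear].
have qE e t : q e t = 4^-1 * ((1 + e ^+ 2) * p t + e * (p (t + g) + p (t - g))).
  rewrite /q /smear autocorrE !big_cons !big_nil /= !subrr !subr0 sub0r !addr0.
  by congr (_ * _); ring.
(* The factor 1/4 makes q 1 and q (-1) add up to p itself. *)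
have := pind _ _ (qp 1) (qp (-1)) _ x.
rewrite !qE => /(_ _)/wrap[t|].
  by rewrite !qE; field.
by rewrite !add0r (proj1 pp) p0; lra.
Qed.

(** The functional [pairing z] is the first one of the lexicographic maximization
    and the point evaluations come next, so that the maximizer is extreme.  The
    competitor is [q / q 0]. *)
Lemma exists_cosine_correlated z q : countable [set: G] -> posdef q ->
  exists p, cosine p /\ pairing z q <= q 0 * pairing z p.
Proof.
move=> Gc qp.
have [e esurj] : exists e : nat -> G, forall g, exists n, e n = g.
  have /countable_injP[f finj] := Gc.
  exists (fun n => if pselect (exists g, f g = n) is left h then projT1 (cid h) else 0).
  move=> g; exists (f g); case: pselect => [h|]; last by case; exists g.
  by case: cid => x /= fx; apply: finj => //; rewrite inE.
have [U [UU ooU]] := @ultraFilterLemma nat \oo _.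
pose l n := if n is m.+1 then [:: (1, e m)] else z.
have [p [pp p0 pmax]] := @lexmax_exists R U UU ooU G l.
have pind : indecomposable p.
  apply: lexmax_indecomposable p0 pmax => g.
  by have [n <-] := esurj g; exists n.+1.
exists p; split; first exact: indecomposable_cosine.
have := posdef_ge0 qp; rewrite le_eqVlt => /predU1P[q0|q0].
  rewrite -q0 mul0r le_eqVlt; apply/orP; left; apply/eqP; apply: big1 => x _.
  by rewrite (posdef_eq0 _ qp (esym q0)) mulr0.
rewrite mulrC -ler_pdivrMr// mulrC -pairingZ.
apply: (pmax 0%N) => //; first by apply: posdefZ => //; rewrite invr_ge0 ltW.
by rewrite mulVf// gt_eqF.
Qed.

End ExtremePoints.

(** * Averages over Folner sets and extraction of atoms *)

Section FolnerAverages.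
Context {R : realType} {G : zmodType}.
Implicit Types (F : {fset G}) (f h : G -> R).

Definition favg F f : R := (\sum_(a <- F) f a) / #|` F|%:R.

Lemma favgZ F c f : favg F (fun a => c * f a) = c * favg F f.
Proof. by rewrite /favg -mulr_sumr mulrA. Qed.

Lemma favgD F f h : favg F (fun a => f a + h a) = favg F f + favg F h.
Proof. by rewrite /favg big_split /= mulrDl. Qed.

Lemma favgB F f h : favg F (fun a => f a - h a) = favg F f - favg F h.
Proof. by rewrite /favg sumrB mulrBl. Qed.

Lemma favg_sum F (I : Type) (s : seq I) (f : I -> G -> R) :
  favg F (fun a => \sum_(i <- s) f i a) = \sum_(i <- s) favg F (f i).
Proof. by rewrite /favg exchange_big /= mulr_suml. Qed.

Lemma favg_exchange F E (f : G -> G -> R) :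
  favg F (fun a => favg E (f a)) = favg E (fun b => favg F (f^~ b)).
Proof. by rewrite /favg -!mulr_suml exchange_big /= mulrAC. Qed.

Lemma card_gt0R F : F != fset0 -> 0 < #|` F|%:R :> R.
Proof. by move=> F0; rewrite ltr0n cardfs_gt0. Qed.

Lemma favg_cst F c : F != fset0 -> favg F (fun=> c) = c.
Proof.
move=> F0; rewrite /favg big_const_seq count_predT iter_addr_0.
by rewrite -(mulr_natr c) mulfK// gt_eqF// card_gt0R.
Qed.

Lemma ler_favg F f h : (forall a, f a <= h a) -> favg F f <= favg F h.
Proof. by move=> fh; rewrite ler_wpM2r ?invr_ge0//; apply: ler_sum. Qed.

Lemma favg_ge0 F f : (forall a, 0 <= f a) -> 0 <= favg F f.
Proof. by move=> f0; rewrite mulr_ge0 ?invr_ge0//; apply: sumr_ge0. Qed.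

Lemma favg_norm_le F f c : F != fset0 -> (forall a, `|f a| <= c) -> `|favg F f| <= c.
Proof.
move=> F0 fc; rewrite ler_norml; apply/andP; split.
  rewrite -[X in X <= _](favg_cst _ F0); apply: ler_favg => a.
  by have := fc a; rewrite ler_norml => /andP[].
rewrite -[X in _ <= X](favg_cst _ F0); apply: ler_favg => a.
by have := fc a; rewrite ler_norml => /andP[].
Qed.

(** The variance of [f] on [F] is nonnegative. *)
Lemma favg_sqr_le F f : F != fset0 -> favg F f ^+ 2 <= favg F (fun a => f a ^+ 2).
Proof.
move=> F0; set m := favg F f.
have : 0 <= favg F (fun a => (f a - m) ^+ 2) by apply: favg_ge0 => a; exact: sqr_ge0.
have -> : (fun a => (f a - m) ^+ 2) = fun a => f a ^+ 2 + (- 2 * m * f a + m ^+ 2).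
  by apply/funext => a; ring.
by rewrite !favgD favgZ favg_cst// -/m; lra.
Qed.

Lemma pairing_autocorr_favg F f (p : G -> R) :
  pairing (autocorr [seq (f a / #|` F|%:R, a) | a <- F]) p =
  favg F (fun a => favg F (fun b => f a * f b * p (a - b))).
Proof.
rewrite autocorrE big_map /favg mulr_suml; apply: eq_bigr => a _.
by rewrite big_map !mulr_suml; apply: eq_bigr => b _ /=; ring.
Qed.

Definition boundary F (g : G) : R :=
  #|` fsymdiff F [fset (x + g)%R | x in F]%fset|%:R / #|` F|%:R.

(** The two sums differ by the sums over the two halves of the symmetric
    difference of [F] and [F + g]. *)
Lemma favg_shift F f c g : (forall a, `|f a| <= c) ->
  `|favg F (fun a => f (a + g)) - favg F f| <= c * boundary F g.
Proof.
move=> fc; set E := [fset (x + g)%R | x in F]%fset.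
have sumE : \sum_(a <- F) f (a + g) = \sum_(a <- E) f a.
  by rewrite big_imfset//= => x y _ _; exact: addIr.
have split_sum (A B : {fset G}) : \sum_(a <- A) f a =
    \sum_(a <- (A `&` B)%fset) f a + \sum_(a <- (A `\` B)%fset) f a.
  rewrite (big_fsetID _ (mem B)) /=; congr (_ + _); apply: eq_fbigl => x; rewrite !inE//.
  by rewrite andbC.
rewrite /favg /boundary -/E sumE -mulrBl normrM mulrA.
rewrite [X in _ * X]ger0_norm ?invr_ge0// ler_wpM2r ?invr_ge0//.
rewrite (split_sum E F) (split_sum F E) fsetIC opprD addrACA subrr add0r.
have sum_le (A : {fset G}) : `|\sum_(a <- A) f a| <= c * #|` A|%:R.
  apply: (le_trans (ler_norm_sum _ _ _)).
  apply: (@le_trans _ _ (\sum_(a <- A) c)); first by apply: ler_sum.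
  by rewrite big_const_seq count_predT iter_addr_0 mulr_natr.
apply: (le_trans (ler_normB _ _)); apply: (le_trans (lerD (sum_le _) (sum_le _))).
rewrite -mulrDr -natrD; have c0 : 0 <= c by apply: (le_trans (normr_ge0 (f 0))).
apply: ler_wpM2l => //; rewrite ler_nat /fsymdiff cardfsU.
rewrite [X in (_ - X)%N](_ : _ = 0%N) ?subn0 1?addnC//.
apply/eqP; rewrite cardfs_eq0; apply/eqP/fsetP => x; rewrite !inE.
by case: (x \in F); rewrite /= ?andbF ?andbT.
Qed.

End FolnerAverages.

Section AtomExtraction.
Context {R : realType} {G : zmodType} (U : set_system nat) {UU : UltraFilter U}.
Context (oo_U : \oo `<=` U) (Phi : nat -> {fset G}) (Phi_folner : folner R Phi).
Implicit Types (p q psi : G -> R).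

Let Phi_neq0 n : Phi n != fset0 := proj1 Phi_folner n.

Lemma boundary_cvg0 g : (fun n => boundary (Phi n) g : R) @ U --> (0 : R).
Proof. by apply: cvgU => //; exact: (proj2 Phi_folner). Qed.

Definition corr F p q : R :=
  favg F (fun a => favg F (fun b => p (a - b) * q (a - b))).

Lemma corr_norm_le F p q : F != fset0 ->
  (forall t, `|p t| <= 1) -> (forall t, `|q t| <= 1) -> `|corr F p q| <= 1.
Proof.
move=> F0 p1 q1; apply: favg_norm_le => // a; apply: favg_norm_le => // b.
by rewrite normrM mulr_ile1.
Qed.

(** After moving the shift by [u] from [psi] to [p], which costs one boundary term,
    the two orders of summation give the shifts of [p] by [u] and by [- u].
    By d'Alembert's equation their mean is [p u] times [p]. *)
Lemma corr_shift F p psi u : F != fset0 -> cosine p -> posdef psi -> psi 0 <= 1 ->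
  `|corr F p (fun t => psi (t + u)) - p u * corr F p psi| <= boundary F u.
Proof.
move=> F0 pc psip psi1.
have psi_le t : `|psi t| <= 1 by apply: (le_trans (posdef_le t psip)).
have p_le t := cosine_le1 t pc.
pose f a := favg F (fun b => p (a - b - u) * psi (a - b)).
have -> : corr F p (fun t => psi (t + u)) = favg F (fun a => f (a + u)).
  congr favg; apply/funext => a; congr favg; apply/funext => b.
  by rewrite [a + u - b]addrAC addrK.
have -> : p u * corr F p psi = favg F f.
  have sym : favg F f = favg F (fun a => favg F (fun b => p (a - b + u) * psi (a - b))).
    rewrite /f favg_exchange; congr favg; apply/funext => a.
    congr favg; apply/funext => b.
    case: pc => -[pN _] _ _ /=.
    have -> : a - b - u = - (b - a + u) by rewrite opprD opprB.
    by rewrite pN -(proj1 psip (a - b)) opprB.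
  have : favg F f + favg F f = 2 * (p u * corr F p psi).
    rewrite {2}sym -favgD /corr -!favgZ; congr favg; apply/funext => a.
    rewrite -favgD -!favgZ; congr favg; apply/funext => b.
    rewrite -mulrDl addrC; case: pc => _ _ /(_ (a - b) u) H.
    by rewrite addrC in H; rewrite addrC H; ring.
  lra.
rewrite -[X in _ <= X]mul1r; apply: favg_shift => a.
by apply: favg_norm_le => // b; rewrite normrM mulr_ile1.
Qed.

Lemma pairing_corr z F p q :
  pairing z (fun u => corr F p (fun t => q (t + u))) =
  corr F p (fun t => pairing z (fun u => q (t + u))).
Proof.
rewrite /pairing /corr; under eq_bigr do rewrite -favgZ.
rewrite -favg_sum; congr favg; apply/funext => a.
under eq_bigr do rewrite -favgZ.
rewrite -favg_sum; congr favg; apply/funext => b.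
by rewrite mulr_sumr; apply: eq_bigr => x _; rewrite mulrCA.
Qed.

(** For each good [n] a cosine [s n] correlates with [psi] on [Phi n] by at least
    [kappa]; let [p] be the limit of the [s n].  The form of [psi] at a measure
    [z] is the maximum of [smear z psi], so it dominates the average of
    [smear z psi] against [s n]; by [corr_shift] this average tends to the
    form of [p] at [z] times a number that is at least [kappa]. *)
Lemma atom_extraction psi (kappa : R) : countable [set: G] ->
  posdef psi -> psi 0 <= 1 -> 0 < kappa ->
  (\forall n \near U, kappa <= corr (Phi n) psi psi) ->
  exists p, cosine p /\ posdef (fun t => psi t - kappa * p t).
Proof.
move=> Gc psip psi1 kappa0 near_k.
have psi_le t : `|psi t| <= 1 by apply: (le_trans (posdef_le t psip)).
have psi0 := posdef_ge0 psip.
have /choice[s sP] : forall n, exists p, cosine p /\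
    (kappa <= corr (Phi n) psi psi -> kappa <= corr (Phi n) p psi).
  move=> n; pose F := Phi n.
  pose z : seq (R * G) :=
    [seq (psi (a - b) / #|` F|%:R / #|` F|%:R, a - b) | a <- F, b <- F].
  have zE q : pairing z q = corr F q psi.
    rewrite /pairing /z big_allpairs_dep /corr /favg mulr_suml; apply: eq_bigr => a _.
    by rewrite !mulr_suml; apply: eq_bigr => b _ /=; ring.
  have [p [pc]] := exists_cosine_correlated z Gc psip.
  rewrite !zE => h; exists p; split=> // kh; have {h} := le_trans kh h.
  move: (corr F p psi) => X kX; have X0 : 0 <= X by rewrite leNgt; apply/negP => ?; nra.
  by apply: (le_trans kX); rewrite ler_piMl.
have [p [pp p0 sp]] := normalized_ulim (fun n => let: And3 h _ _ := proj1 (sP n) in h)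
  (fun n => let: And3 _ h _ := proj1 (sP n) in h).
have pc : cosine p.
  split => // x g; apply: (@cvgU_unique _ U _ (fun n => s n (x + g) + s n (x - g))).
    exact: cvgD.
  have -> : (fun n => s n (x + g) + s n (x - g)) = fun n => 2 * s n x * s n g.
    by apply/funext => n; case: (sP n) => -[_ _ ->].
  by apply: cvgM => //; exact: cvgMr.
exists p; split => //; split => [g|z].
  by rewrite (proj1 psip) (proj1 pp).
pose c n := corr (Phi n) (s n) psi.
have [c0 cc0] : exists c0 : R, c @ U --> c0.
  exists (ulim U c); apply: (@ulimP R U UU c 1); apply: nearW => n.
  by apply: corr_norm_le => // t; apply: cosine_le1; case: (sP n).
have kc0 : kappa <= c0.
  apply: (@cvgU_le _ U _ (fun=> kappa) c) => //; first exact: cvg_cst.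
  by apply: filterS near_k => n; case: (sP n) => _; exact.
pose E n u := corr (Phi n) (s n) (fun t => psi (t + u)).
have E_cvg u : E^~ u @ U --> p u * c0.
  have -> : E^~ u = fun n => (E n u - s n u * c n) + s n u * c n.
    by apply/funext => n; rewrite subrK.
  rewrite -[X in _ --> X]add0r; apply: cvgD; last exact: cvgM.
  apply: norm_cvg0.
  apply: (@squeeze_cvgr _ U _ _ (fun=> 0) (fun n => boundary (Phi n) u)).
  - apply: nearW => n; rewrite normr_ge0 /=.
    by apply: corr_shift => //; case: (sP n).
  - exact: cvg_cst.
  - exact: boundary_cvg0.
have le_psi : pairing (autocorr z) p * c0 <= pairing (autocorr z) psi.
  rewrite mulrC -pairingZ.
  apply: (@cvgU_le _ U _ (fun n => pairing (autocorr z) (E n))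
    (fun=> pairing (autocorr z) psi)).
  - have -> : (fun t => c0 * p t) = fun t => p t * c0 by apply/funext => t; rewrite mulrC.
    exact: cvgU_pairing.
  - exact: cvg_cst.
  apply: nearW => n; rewrite /E pairing_corr -smear0.
  rewrite -[X in _ <= X](favg_cst _ (Phi_neq0 n)) -[X in _ <= X](favg_cst _ (Phi_neq0 n)).
  apply: ler_favg => a; apply: ler_favg => b.
  apply: (le_trans (ler_norm _)); rewrite normrM -[X in _ <= X]mul1r.
  apply: ler_pM => //; first by apply: cosine_le1; case: (sP n).
  exact: (posdef_le _ (posdef_smear z psip)).
have -> : (fun t => psi t - kappa * p t) = fun t => 1 * psi t + (- kappa) * p t.
  by apply/funext => t; rewrite mul1r mulNr.
rewrite pairing_lin; have := proj2 pp z.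
move: le_psi; move: (pairing _ p) (pairing _ psi) => X Y XY X0.
rewrite mul1r mulNr subr_ge0; apply: le_trans XY.
by rewrite [X * c0]mulrC ler_wpM2r.
Qed.

End AtomExtraction.

(** * Cosine functions are real parts of characters *)

Section CosinesAreCharacters.
Context {R : realType} {G : zmodType}.
Implicit Types (p s : G -> R).

(** In terms of an angle [t] with [p = cos t], the sine is recovered from a shift:
    [sin t_x = (p x p g - p (x + g)) / sin t_g] for any [g] with
    [p g ^ 2 <> 1].  If there is no such [g], then [p] is itself a character
    with values 1 and -1 and the sine vanishes. *)
Lemma cosine_sine p : cosine p ->
  exists s, [/\ forall x, p x ^+ 2 + s x ^+ 2 = 1,
    forall x y, p (x + y) = p x * p y - s x * s y &
    forall x y, s (x + y) = s x * p y + p x * s y].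
Proof.
move=> pc; case: (pc) => [[pN _] p0 H].
have H2 y : p (y + y) = 2 * p y ^+ 2 - 1.
  by have := H y y; rewrite subrr p0 => h; lra.
(* Obtained from p (x + y) p (x - y) = p x ^ 2 + p y ^ 2 - 1. *)
have Q x y : p (x + y) ^+ 2 = 2 * p x * p y * p (x + y) + 1 - p x ^+ 2 - p y ^+ 2.
  have := H (x + y) (x - y).
  have -> : x + y + (x - y) = x + x by rewrite addrACA subrr addr0.
  have -> : x + y - (x - y) = y + y.
    by rewrite opprB addrC [x + y]addrC addrACA addNr addr0.
  rewrite !H2; have := H x y; move: (p (x + y)) (p (x - y)) (p x) (p y) => A B C D h1.
  have -> : B = 2 * C * D - A by lra.
  by move=> h2; lra.
have [p1|/existsNP[g pg]] := pselect (forall g, p g ^+ 2 = 1).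
  exists (fun=> 0); split => [x|x y|x y].
  - by rewrite expr0n addr0.
  - rewrite mulr0 subr0; have := Q x y; rewrite !p1 => h.
    have -> : p (x + y) = (p x * p y) * (p x * p y) * p (x + y).
      by rewrite -expr2 exprMn !p1 !mul1r.
    rewrite -mulrA; suff -> : p x * p y * p (x + y) = 1 by rewrite mulr1.
    by lra.
  - by rewrite !(mul0r, mulr0) addr0.
have pg_lt : 0 < 1 - p g ^+ 2.
  rewrite lt_neqAle subr_ge0 eq_sym subr_eq0 eq_sym; apply/andP; split; first exact/eqP.
  by rewrite -[p g ^+ 2]ger0_norm ?sqr_ge0// normrX exprn_ile1// cosine_le1.
pose r := Num.sqrt (1 - p g ^+ 2).
have r2 : r ^+ 2 = 1 - p g ^+ 2 by rewrite sqr_sqrtr// ltW.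
have r0 : r != 0 by rewrite sqrtr_eq0 -ltNge.
pose s x := (p x * p g - p (x + g)) / r.
have ps x : p x ^+ 2 + s x ^+ 2 = 1.
  have -> : s x ^+ 2 = (p x * p g - p (x + g)) ^+ 2 / r ^+ 2 by rewrite exprMn exprVn.
  have -> : (p x * p g - p (x + g)) ^+ 2 = (1 - p x ^+ 2) * r ^+ 2.
    by rewrite r2; have := Q x g; move: (p x) (p g) (p (x + g)) => A B C; lra.
  by rewrite mulfK ?expf_neq0// addrC subrK.
have pB x y : p (x - y) = 2 * p x * p y - p (x + y) by have := H x y; lra.
have S x y : p x * p (y + g) + p y * p (x + g) = p (x + y + g) + p (x - y) * p g.
  have := H x (y + g); have := H y (x + g); have := H (x - y) g.
  have -> : x + (y + g) = x + y + g by rewrite addrA.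
  have -> : y + (x + g) = x + y + g by rewrite addrCA addrA.
  have -> : x - (y + g) = x - y - g by rewrite opprD addrA.
  have -> : y - (x + g) = - (x - y + g) by rewrite !opprD opprK addrA (addrC y).
  by rewrite pN; lra.
have T x y : p (x + g) * p (y + g) = p (x + y + g) * p g + p x * p y - p (x + y).
  have := H (x + g) (y + g); have := H (x + y + g) g; have := H x y.
  have -> : x + g + (y + g) = x + y + g + g by rewrite addrACA addrA.
  have -> : x + g - (y + g) = x - y by rewrite opprD addrACA subrr addr0.
  have -> : x + y + g - g = x + y by rewrite addrK.
  by lra.
have rs x : r * s x = p x * p g - p (x + g) by rewrite /s mulrCA divff// mulr1.
exists s; split => // x y.
  apply: (mulfI (expf_neq0 2 r0)); have -> : r ^+ 2 * (p x * p y - s x * s y) =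
    r ^+ 2 * (p x * p y) - (r * s x) * (r * s y) by ring.
  rewrite !rs r2; have := S x y; have := T x y; rewrite pB.
  move: (p x) (p y) (p g) (p (x + y)) (p (x + g)) (p (y + g)) (p (x + y + g)).
  move=> a b c d e f h.
  move=> h1 h2; have -> : (a * c - e) * (b * c - f) =
    a * b * c ^+ 2 - c * (a * f + b * e) + e * f by ring.
  by rewrite h1 h2; ring.
apply: (mulfI r0); have -> : r * (s x * p y + p x * s y) =
  r * s x * p y + p x * (r * s y) by ring.
by rewrite !rs; have := S x y; rewrite pB; lra.
Qed.

End CosinesAreCharacters.

(** * Angles in R/Z *)

Section Angles.
Local Open Scope quotient_scope.
Context {R : realType}.
Implicit Types (t : R).

Lemma cosB2piz t (m : int) : cos (t - pi *+ 2 * m%:~R) = cos t :> R.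
Proof.
have H (n : nat) u : cos (u + pi *+ 2 * n%:R) = cos u :> R.
  elim: n u => [|n IH] u; first by rewrite mulr0 addr0.
  by rewrite -natr1 mulrDr mulr1 addrA cosD2pi IH.
case: m => n; first by rewrite -[LHS](H n) subrK.
by rewrite NegzE mulrNz mulrN opprK H.
Qed.

(** The fractional part [r] of [t] also has cosine 1, and the cosine is injective on
    the segment from 0 to [pi]; for [r > 1/2] use [1 - r]. *)
Lemma cos_eq1_int t : cos (pi *+ 2 * t) = 1 -> t \is a Num.int.
Proof.
have pi0 := pi_gt0 R.
pose m := Num.floor t; pose r := t - m%:~R => c1.
have [r0 r1] : 0 <= r /\ r < 1.
  by have := floor_itv t; rewrite /r -/m intrD => /andP[? ?]; split; lra.
have cr : cos (pi *+ 2 * r) = 1 by rewrite /r mulrBr cosB2piz.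
suff : r = 0 by move/eqP; rewrite subr_eq0 => /eqP ->; exact: intr_int.
have in0 : (0 : R) \in `[0, pi] by rewrite in_itv /= lexx ltW.
have [rh|rh] := leP r (2^-1).
  have inr : pi *+ 2 * r \in `[0, pi] by rewrite in_itv /=; apply/andP; split; nra.
  have /eqP : pi *+ 2 * r = 0 by apply: (cos_inj inr in0); rewrite cr cos0.
  by rewrite mulf_eq0 mulrn_eq0/= gt_eqF//= => /eqP.
have inr : pi *+ 2 * (1 - r) \in `[0, pi] by rewrite in_itv /=; apply/andP; split; nra.
have /eqP : pi *+ 2 * (1 - r) = 0.
  apply: (cos_inj inr in0); rewrite cos0 -cosN -mulrN opprB mulrBr.
  by rewrite (cosB2piz _ 1).
by rewrite mulf_eq0 mulrn_eq0/= gt_eqF//= => /eqP; lra.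
Qed.

Lemma angle_exists (c s : R) : c ^+ 2 + s ^+ 2 = 1 ->
  exists t, cos (pi *+ 2 * t) = c /\ sin (pi *+ 2 * t) = s.
Proof.
move=> cs1.
have c1 : -1 <= c <= 1.
  have s0 := sqr_ge0 s; rewrite -ler_norml -(@expr_le1 _ 2)// real_normK ?num_real//; lra.
have [/andP[a0 a1] ca] := acos_def c1.
have sa : sin (acos c) = `|s| by rewrite sin_acos// -cs1 addrC addKr sqrtr_sqr.
have pi0 : pi *+ 2 != 0 :> R by rewrite mulrn_eq0/= gt_eqF// pi_gt0.
have [s0|s0] := leP 0 s.
  by exists (acos c / (pi *+ 2)); rewrite mulrC divfK// ca sa ger0_norm.
exists (- acos c / (pi *+ 2)); rewrite mulrC divfK// cosN sinN ca sa.
by rewrite ltr0_norm// opprK.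
Qed.

Lemma cos_near1 (e : R) : 0 < e ->
  exists2 eta : R, 0 < eta & forall t, dist_int t < eta -> 1 - cos (pi *+ 2 * t) < e.
Proof.
move=> e0.
have /cvgrPdist_lt/(_ e e0)/nbhs_ballP[d /= d0 dP] := @continuous_cos R 0.
have pi0 : 0 < pi *+ 2 :> R by rewrite mulrn_wgt0 ?pi_gt0.
exists (d / (pi *+ 2)); first by rewrite divr_gt0.
move=> t /inf_lt[]; first by exists `|t - 0%:~R|, 0.
move=> _ [m _ <-]; rewrite ltr_pdivlMr// => tm.
have := dP (pi *+ 2 * (t - m%:~R)).
rewrite /ball /= sub0r normrN normrM (gtr0_norm pi0) mulrC => /(_ tm).
rewrite cos0 mulrBr cosB2piz; apply: le_lt_trans; exact: ler_norm.
Qed.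

(** The angle of [(p x, s x)], in turns, is additive modulo 1 by the addition
    formulas. *)
Lemma cosine_torus (G : zmodType) (p : G -> R) : cosine p ->
  exists rho : {additive G -> torus R},
    forall x, exists2 t, rho x = \pi_(torus R) t & p x = cos (pi *+ 2 * t).
Proof.
move=> /cosine_sine[s [ps pD sD]].
have /choice[th thP] : forall x, exists t,
    cos (pi *+ 2 * t) = p x /\ sin (pi *+ 2 * t) = s x.
  by move=> x; exact: angle_exists.
pose f x : torus R := \pi_(torus R) (th x).
have fD x y : f (x + y) = f x + f y.
  rewrite /f -[RHS](@Quotient.pi_add R).
  apply/torus_piP; apply: cos_eq1_int.
  rewrite mulrBr cosB mulrDr cosD sinD.
  case: (thP x) => -> ->; case: (thP y) => -> ->; case: (thP (x + y)) => -> ->.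
  rewrite -pD [s x * p y + _]addrC [p x * s y + _]addrC -sD -!expr2; exact: ps.
have fB : zmod_morphism f.
  by move=> x y; have := fD (x - y) y; rewrite subrK => ->; rewrite addrK.
pose h := GRing.isZmodMorphism.Build G (torus R) f fB.
exists (HB.pack_for {additive G -> torus R} f h) => x.
by exists (th x) => //=; case: (thP x).
Qed.

End Angles.

(** * Autocorrelation of a set and its almost periodic part *)

Section BohrNeighborhoods.
Context {R : realType} {G : zmodType} (U : set_system nat) {UU : UltraFilter U}.
Context (oo_U : \oo `<=` U) (Phi : nat -> {fset G}) (Phi_folner : folner R Phi).
Implicit Types (p q psi : G -> R).

(** By induction on [N]: as long as the self-correlation stays at least [kappa], a
    cosine of weight [kappa] splits off and the value at 0 drops by [kappa].
    Cosines of weight 0 fill up the sum when this stops early, so that [N] does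
    not depend on [psi]. *)
Lemma finite_atoms_plus_small (kappa : R) N psi : countable [set: G] ->
  0 < kappa -> posdef psi -> psi 0 <= 1 -> psi 0 <= N%:R * kappa ->
  exists (p : nat -> G -> R) (w : nat -> R) r,
    [/\ forall i, cosine (p i), forall i, 0 <= w i, posdef r,
        forall t, psi t = \sum_(i < N) w i * p i t + r t &
        \forall n \near U, corr (Phi n) r r < kappa].
Proof.
move=> Gc k0; elim: N psi => [|N IH] psi psip psi1 psiN.
  exists (fun _ _ => 1), (fun=> 0), psi; split => //.
    by move=> _; exact: cosine_one.
    by move=> t; rewrite big_ord0 add0r.
  apply: nearW => n; suff -> : psi = fun=> 0.
    by rewrite /corr /favg mul0r !(big1, mul0r)//.
  apply/funext => t; apply: posdef_eq0 => //; apply/eqP.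
  by rewrite eq_le posdef_ge0// andbT; move: psiN; rewrite mul0r.
case: (@ultra_or U UU [set n | kappa <= corr (Phi n) psi psi]) => near_k; last first.
  exists (fun _ _ => 1), (fun=> 0), psi; split => //.
    by move=> _; exact: cosine_one.
    by move=> t; rewrite big1 ?add0r// => i _; rewrite mul0r.
  by apply: filterS near_k => n /= /negP; rewrite -ltNge.
have [q [qc qp]] := atom_extraction oo_U Phi_folner Gc psip psi1 k0 near_k.
have q0 : q 0 = 1 by case: qc.
have [||p [w [r [pc w0 rp rE r_small]]]] := IH _ qp; rewrite ?q0.
- by lra.
- by move: psiN; rewrite -natr1; lra.
exists (fun i => if i is j.+1 then p j else q).
exists (fun i => if i is j.+1 then w j else kappa), r.
split => //; [by case|by case=> //=; exact: ltW|] => t.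
by rewrite big_ord_recl -addrA -[X in _ + X]rE addrC subrK.
Qed.

Section Autocorrelation.
Context (u : G -> R) (u01 : forall x, 0 <= u x <= 1) (d : R).
Context (u_density : (fun n => favg (Phi n) u) @ \oo --> d).

Let Phi_neq0 n : Phi n != fset0 := proj1 Phi_folner n.

(** For the indicator function [u] of a set [A], the density of [A] intersected
    with [A - g]. *)
Definition autocorrelation (g : G) : R :=
  ulim U (fun n => favg (Phi n) (fun x => u x * u (x + g))).

Let uu_le x y : `|u x * u y| <= 1.
Proof.
have /andP[x0 x1] := u01 x; have /andP[y0 y1] := u01 y.
by rewrite ger0_norm ?mulr_ge0// mulr_ile1.
Qed.

Lemma favg_shift_cvg (f : G -> R) g (l : R) : (forall x, `|f x| <= 1) ->
  (fun n => favg (Phi n) f) @ U --> l ->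
  (fun n => favg (Phi n) (fun x => f (x + g))) @ U --> l.
Proof.
move=> f1 fl.
have -> : (fun n => favg (Phi n) (fun x => f (x + g))) =
   (fun n => (favg (Phi n) (fun x => f (x + g)) - favg (Phi n) f) + favg (Phi n) f).
  by apply/funext => n; rewrite subrK.
rewrite -[X in _ --> X]add0r; apply: cvgD => //; apply: norm_cvg0.
apply: (@squeeze_cvgr _ U _ _ (fun=> 0) (fun n => boundary (Phi n) g)).
- by apply: nearW => n; rewrite normr_ge0 /= -[X in _ <= X]mul1r; exact: favg_shift.
- exact: cvg_cst.
- exact: boundary_cvg0.
Qed.

Lemma autocorrelation_cvg g h :
  (fun n => favg (Phi n) (fun x => u (x + g) * u (x + h))) @ U -->
    autocorrelation (h - g).
Proof.
have H : (fun n => favg (Phi n) (fun x => u x * u (x + (h - g)))) @ U -->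
    autocorrelation (h - g).
  apply: (@ulimP _ U UU _ 1); apply: nearW => n.
  exact: favg_norm_le.
have := favg_shift_cvg g (fun x => uu_le x (x + (h - g))) H.
suff -> : (fun x => u (x + g) * u (x + h)) =
  fun x => u (x + g) * u (x + g + (h - g)) by [].
by apply/funext => x; rewrite addrA addrAC addrK.
Qed.

(** The right-hand side is the mean of the square of the function
    [y |-> sum_(x <- z) x.1 * u (y + x.2)], and the square of the mean of this
    function is the left-hand side. *)
Lemma autocorrelation_ge z :
  (d * \sum_(x <- z) x.1) ^+ 2 <= pairing (autocorr z) autocorrelation.
Proof.
pose f n := favg (Phi n) (fun y => \sum_(x <- z) x.1 * u (y + x.2)).
have f_cvg : f @ U --> d * \sum_(x <- z) x.1.
  have -> : f = fun n => \sum_(x <- z) x.1 * favg (Phi n) (fun y => u (y + x.2)).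
    by apply/funext => n; rewrite /f favg_sum; apply: eq_bigr => x _; rewrite favgZ.
  rewrite mulr_sumr; under [X in _ --> X]eq_bigr do rewrite mulrC.
  apply: cvgU_sum => x; apply: cvgMr; apply: favg_shift_cvg; last exact: cvgU.
  by move=> y; have /andP[y0 y1] := u01 y; rewrite ger0_norm.
pose h n := favg (Phi n) (fun y => (\sum_(x <- z) x.1 * u (y + x.2)) ^+ 2).
have h_cvg : h @ U --> pairing (autocorr z) autocorrelation.
  have -> : h = fun n => \sum_(x <- z) \sum_(y <- z) x.1 * y.1 *
      favg (Phi n) (fun t => u (t + y.2) * u (t + x.2)).
    apply/funext => n; rewrite /h.
    have -> : (fun y => (\sum_(x <- z) x.1 * u (y + x.2)) ^+ 2) =
       fun t => \sum_(x <- z) \sum_(y <- z) x.1 * y.1 * (u (t + y.2) * u (t + x.2)).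
      apply/funext => t; rewrite expr2 mulr_suml; apply: eq_bigr => x _.
      by rewrite mulr_sumr; apply: eq_bigr => y _; ring.
    rewrite favg_sum; apply: eq_bigr => x _.
    by rewrite favg_sum; apply: eq_bigr => y _; rewrite favgZ.
  rewrite autocorrE; apply: cvgU_sum => x; apply: cvgU_sum => y; apply: cvgMr.
  exact: autocorrelation_cvg.
apply: (@cvgU_le _ U _ (fun n => f n * f n) h) => //.
  by rewrite expr2; apply: cvgM.
by apply: nearW => n; rewrite -expr2; exact: favg_sqr_le.
Qed.

Lemma autocorrelation_posdef : posdef autocorrelation.
Proof.
split=> [g|z]; last by apply: le_trans (autocorrelation_ge z); exact: sqr_ge0.
have := @autocorrelation_cvg g 0; rewrite sub0r => H.
apply: (cvgU_unique H); have := @autocorrelation_cvg 0 g; rewrite subr0.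
suff -> : (fun x => u (x + g) * u (x + 0)) = fun x => u (x + 0) * u (x + g) by [].
by apply/funext => x; rewrite mulrC.
Qed.

Lemma autocorrelation0_le1 : autocorrelation 0 <= 1.
Proof.
have := @autocorrelation_cvg 0 0; rewrite subrr => H.
apply: (@cvgU_le _ U _ _ (fun=> 1) _ _ H (cvg_cst _)); apply: nearW => n.
by apply: (le_trans (ler_norm _)); apply: favg_norm_le.
Qed.

Lemma autocorrelation_gt0 g : 0 < autocorrelation g ->
  exists x, u x != 0 /\ u (x + g) != 0.
Proof.
move=> Hg; apply: contrapT => no.
have := @autocorrelation_cvg 0 g; rewrite subr0 => H.
suff : autocorrelation g = 0 by move=> H0; rewrite H0 ltxx in Hg.
apply: (cvgU_unique H).
have -> : (fun n => favg (Phi n) (fun x => u (x + 0) * u (x + g))) = fun=> 0.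
  apply/funext => n; rewrite /favg big1 ?mul0r// => x _; rewrite addr0.
  have [->|ux] := eqVneq (u x) 0; first by rewrite mul0r.
  have [->|ug] := eqVneq (u (x + g)) 0; first by rewrite mulr0.
  by case: no; exists x.
exact: cvg_cst.
Qed.

End Autocorrelation.

(** Cauchy-Schwarz twice: the square of the left-hand side is bounded, for every
    [y], by the form [Q] of [r] at the measure [u] on [F], and [Q ^ 2] is at
    most the mean of [r (a - b) ^ 2]. *)
Lemma favg_convolution_small F (u r : G -> R) (y : G) (m : R) : F != fset0 -> 0 <= m ->
  (forall x, 0 <= u x <= 1) -> posdef r -> r 0 <= 1 -> corr F r r < m ^+ 4 ->
  `|favg F (fun b => u b * r (y - b))| <= m.
Proof.
move=> F0 m0 u01 rp r1 rsmall.
pose z : seq (R * G) := [seq (u a / #|` F|%:R, a) | a <- F].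
set S := favg _ _; set Q := pairing (autocorr z) r.
have SQ : S ^+ 2 <= Q.
  have := posdef_CS z y rp; rewrite big_map /= -/Q.
  have -> : \sum_(a <- F) u a / #|` F|%:R * r (y - a) = S.
    by rewrite /S /favg mulr_suml; apply: eq_bigr => a _; rewrite mulrAC.
  move=> /le_trans; apply; rewrite ler_piMl//; exact: (proj2 rp).
have Q2 : Q ^+ 2 <= corr F r r.
  rewrite /Q pairing_autocorr_favg; apply: (le_trans (favg_sqr_le _ F0)).
  apply: ler_favg => a; apply: (le_trans (favg_sqr_le _ F0)); apply: ler_favg => b.
  have /andP[a0 a1] := u01 a; have /andP[b0 b1] := u01 b.
  rewrite exprMn -expr2 ler_piMl ?sqr_ge0// exprn_ile1 ?mulr_ge0// mulr_ile1//.
have S4 : `|S| ^+ 4 <= m ^+ 4.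
  rewrite (exprM _ 2 2) real_normK ?num_real//.
  apply: le_trans (ltW rsmall); apply: le_trans Q2.
  by rewrite ler_sqr ?nnegrE ?sqr_ge0// (le_trans _ SQ)// sqr_ge0.
by rewrite -(@ler_pXn2r _ 4)// nnegrE.
Qed.

End BohrNeighborhoods.

(** * Bohr neighborhoods in A + A - A *)

(** Write [c = e ^ 4].  The convolution [H] exceeds [c] at [a].  Passing from [a] to
    [a + x] changes its almost periodic part by at most [c / 4], and its
    remaining part is at most [c / 8] at both points; this is where the
    constants of the statement come from.  Hence [H (a + x) > 0]. *)
Lemma sumdiff_contains_cosine_neighborhood (R : realType) (G : zmodType) (e : R)
    (A : set G) (Phi : nat -> {fset G}) (d : R) (N : nat) :
  countable [set: G] -> 0 < e -> folner R Phi -> has_density Phi A d -> e < d ->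
  1 <= N%:R * (e ^+ 4 / 8) ^+ 4 ->
  exists2 a, A a & exists2 p : nat -> G -> R, (forall i, cosine (p i)) &
    forall x, (forall i, (i < N)%N -> 1 - p i x < (e ^+ 4 / 4) ^+ 2 / 2) ->
      sumdiff A (a + x).
Proof.
move=> Gc e0 Phi_folner Ad ed N1.
have [U [UU ooU]] := @ultraFilterLemma nat \oo _.
pose c := e ^+ 4; have c0 : 0 < c by exact: exprn_gt0.
pose u (x : G) : R := (x \in A)%:R.
have u01 x : 0 <= u x <= 1 by rewrite /u ler0n lern1 leq_b1.
have uA x : u x != 0 -> A x.
  by rewrite /u; have [/set_mem|_] := boolP (x \in A); rewrite ?eqxx.
have u_density : (fun n => favg (Phi n) u) @ \oo --> d.
  suff -> : (fun n => favg (Phi n) u) =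
      fun n => #|` [fset x in Phi n | x \in A]%fset|%:R / #|` Phi n|%:R by [].
  apply/funext => n; congr (_ / _).
  rewrite card_fset_sum1 natr_sum big_fset [RHS]big_mkcond /=.
  by apply: eq_bigr => x _; rewrite /u; case: (x \in A).
pose phi := autocorrelation U Phi u.
have phi_pd : posdef phi :=
  autocorrelation_posdef (UU := UU) ooU Phi_folner u01 u_density.
have phi1 : phi 0 <= 1 := autocorrelation0_le1 (UU := UU) ooU Phi_folner u01.
have k0 : 0 < (c / 8) ^+ 4 by rewrite exprn_gt0// divr_gt0.
have [p [w [r [pc w0 rp phiE r_small]]]] :=
  finite_atoms_plus_small (UU := UU) ooU Phi_folner Gc k0 phi_pd phi1 (le_trans phi1 N1).
have near_e : \forall n \near U, e < favg (Phi n) u.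
  apply: ooU; move/cvgrPdist_lt : u_density => /(_ (d - e)).
  rewrite subr_gt0 => /(_ ed); apply: filterS => n /ltr_normlP[_]; lra.
have [n [/= rn en]] := filter_ex (filterI r_small near_e).
set F := Phi n in rn en; have F0 : F != fset0 by exact: (proj1 Phi_folner).
pose H y := favg F (fun b => u b * phi (y - b)).
have w_sum : \sum_(i < N) w i <= 1.
  apply: le_trans phi1; rewrite phiE -[X in X <= _]addr0 lerD ?posdef_ge0//.
  by apply: ler_sum => i _; case: (pc i) => _ -> _; rewrite mulr1.
have r1 : r 0 <= 1.
  apply: le_trans phi1; rewrite phiE lerDr; apply: sumr_ge0 => i _.
  by case: (pc i) => _ -> _; rewrite mulr1.
have [a ca] : exists a, c < u a * H a.
  apply: contrapT => no.
  have : favg F (fun a => u a * H a) <= c.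
    rewrite -[X in _ <= X](favg_cst c F0); apply: ler_favg => a.
    by rewrite leNgt; apply/negP => h; apply: no; exists a.
  apply/negP; rewrite -ltNge.
  (* The mean of u H over F is the form of phi at the measure u on F. *)
  have := autocorrelation_ge (UU := UU) ooU Phi_folner u01 u_density
    [seq (u a / #|` F|%:R, a) | a <- F].
  rewrite pairing_autocorr_favg big_map /= -mulr_suml.
  have -> : favg F (fun a => u a * H a) =
      favg F (fun a => favg F (fun b => u a * u b * phi (a - b))).
    congr favg; apply/funext => a; rewrite -favgZ.
    by congr favg; apply/funext => b; rewrite mulrA.
  apply: lt_le_trans; rewrite -/(favg F u) /c (exprM e 2 2) ltr_sqr ?nnegrE ?sqr_ge0//.
    by rewrite expr2 ltr_pM// ltW.
  by rewrite mulr_ge0// ltW// (lt_trans e0).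
have ua : u a != 0 by apply/eqP => ua0; move: ca; rewrite ua0 mul0r ltNge ltW.
have Ha : c < H a.
  by move: ca ua; rewrite /u; case: (a \in A); rewrite ?mul1r ?eqxx.
exists a; first exact: uA.
exists p => // x px.
have HE y : H y = \sum_(i < N) w i * favg F (fun b => u b * p i (y - b))
    + favg F (fun b => u b * r (y - b)).
  rewrite /H; have -> : (fun b => u b * phi (y - b)) =
     fun b => \sum_(i < N) w i * (u b * p i (y - b)) + u b * r (y - b).
    apply/funext => b; rewrite phiE mulrDr mulr_sumr; congr (_ + _).
    by apply: eq_bigr => i _; rewrite mulrCA.
  by rewrite favgD favg_sum; congr (_ + _); apply: eq_bigr => i _; rewrite favgZ.
have p_close i y : (i < N)%N -> `|p i (y + x) - p i y| <= c / 4.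
  move=> iN; have [pip pi0 _] := pc i.
  have := posdef_krein y x pip; rewrite pi0 mulr1 => h.
  have c40 : 0 <= c / 4 by rewrite divr_ge0// ltW.
  rewrite -(@ler_pXn2r _ 2)// ?nnegrE// real_normK ?num_real//.
  by apply: (le_trans h); have := px i iN; rewrite -/c; lra.
have sum_close : `|\sum_(i < N) w i * favg F (fun b => u b * p i (a + x - b))
   - \sum_(i < N) w i * favg F (fun b => u b * p i (a - b))| <= c / 4.
  rewrite -sumrB; apply: (le_trans (ler_norm_sum _ _ _)).
  apply: (@le_trans _ _ (\sum_(i < N) w i * (c / 4))).
    apply: ler_sum => i _; rewrite -mulrBr normrM (ger0_norm (w0 i)) ler_wpM2l//.
    rewrite -favgB; apply: favg_norm_le => // b; rewrite -mulrBr normrM.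
    have /andP[b0 b1] := u01 b; rewrite (ger0_norm b0) -[X in _ <= X]mul1r.
    by apply: ler_pM => //; rewrite addrAC; exact: p_close.
  by rewrite -mulr_suml ler_piMl// divr_ge0// ltW.
have c80 : 0 <= c / 8 by rewrite divr_ge0// ltW.
have Hax : 0 < H (a + x).
  have := favg_convolution_small (a + x) F0 c80 u01 rp r1 rn.
  have := favg_convolution_small a F0 c80 u01 rp r1 rn.
  move: sum_close Ha; rewrite !HE.
  move: (\sum_(i < N) _) (\sum_(i < N) _) (favg _ _) (favg _ _) => S1 S2 S3 S4.
  by move=> /ler_normlP[h1 h2] h3 /ler_normlP[h4 h5] /ler_normlP[h6 h7]; lra.
have [b [ub phib]] : exists b, u b != 0 /\ 0 < phi (a + x - b).
  apply: contrapT => no.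
  have : H (a + x) <= 0.
    rewrite -(favg_cst 0 F0); apply: ler_favg => b.
    have /andP[b0 _] := u01 b; have [->|ub] := eqVneq (u b) 0; first by rewrite mul0r.
    by apply: mulr_ge0_le0 => //; rewrite leNgt; apply/negP => h; apply: no; exists b.
  by apply/negP; rewrite -ltNge.
have [z [uz uzb]] := autocorrelation_gt0 (UU := UU) ooU Phi_folner u01 phib.
exists b, (z + (a + x - b)), z; split; [exact: uA|exact: uA|exact: uA|].
have -> : b + (z + (a + x - b)) = a + x + z by rewrite addrCA (addrC b) subrK addrC.
by rewrite addrK.
Qed.

(** The bound [N] on the number of cosines becomes the rank of the Bohr set, the
    tolerance for [1 - p x] its radius. *)
Lemma bohr_in_sumdiff (R : realType) (delta : R) : 0 < delta ->
  exists (k : nat) (eta : R), 0 < eta /\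
    forall G : zmodType, countable [set: G] ->
    forall A : set G, delta <= upper_banach_density R A ->
    exists a : G, A a /\ contains_bohr k eta (translate (sumdiff A) (- a)).
Proof.
move=> delta0; pose e := delta / 2; have e0 : 0 < e by rewrite divr_gt0.
pose kappa := (e ^+ 4 / 8) ^+ 4.
have k0 : 0 < kappa by rewrite exprn_gt0// divr_gt0// exprn_gt0.
have tol0 : 0 < (e ^+ 4 / 4) ^+ 2 / 2.
  by rewrite divr_gt0// exprn_gt0// divr_gt0// exprn_gt0.
have [eta eta0 etaP] := cos_near1 tol0.
pose N := Num.bound kappa^-1.
have N1 : 1 <= N%:R * kappa.
  rewrite -ler_pdivrMr// mul1r ltW//.
  by apply: archi_boundP; rewrite invr_ge0 ltW.
exists N, eta; split => // G Gc A Adelta.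
have [d [Phi [Phi_folner Ad]] ed] : exists2 d,
    (exists Phi, folner R Phi /\ has_density Phi A d) & e < d.
  apply: sup_gt; last first.
    by apply: lt_le_trans Adelta; rewrite /e ltr_pdivrMr//; lra.
  apply/set0P/negP => /eqP S0; move: Adelta.
  by rewrite /upper_banach_density S0 sup0 leNgt delta0.
have [a Aa [p pc pP]] :=
  sumdiff_contains_cosine_neighborhood Gc e0 Phi_folner Ad ed N1.
exists a; split => //.
have /choice[rho rhoP] : forall i : 'I_N, exists rho : {additive G -> torus R},
    forall x, tnorm (rho x) < eta -> 1 - p i x < (e ^+ 4 / 4) ^+ 2 / 2.
  move=> i; have [rho rhoP] := cosine_torus (pc i); exists rho => x.
  by have [t -> ->] := rhoP x; rewrite tnorm_pi; exact: etaP.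
exists [set g | forall i, tnorm (rho i g) < eta]; split; first by exists rho.
move=> g /= gB; exists (a + g); last by rewrite addrC addKr.
by apply: pP => i iN; apply: (rhoP (Ordinal iN)).
Qed.

Theorem theorem2p2 (R : realType) (delta : R) (delta_gt0 : 0 < delta) :
  (exists (k : nat) (eta : R), 0 < eta /\
    forall G : zmodType, countable [set: G] ->
    forall A : set G, delta <= upper_banach_density R A ->
    exists a : G, A a /\
      contains_bohr k eta (translate (sumdiff A) (- a)))
  /\
  (forall eps : R, 0 < eps ->
   exists (k' : nat) (eta' : R), 0 < eta' /\
    forall G : zmodType, countable [set: G] ->
    forall A : set G, delta <= upper_banach_density R A ->
    exists A' : set G,
      [/\ A' `<=` A,
          upper_banach_density R (A `\` A') < eps &
          forall a' : G, A' a' ->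
            contains_bohr k' eta' (translate (sumdiff A) (- a'))]).
Proof.
split=> [|eps eps0]; first exact: bohr_in_sumdiff.
have [k [eta [eta0 H]]] := bohr_in_sumdiff eps0.
exists k, eta; split => // G Gc A _.
exists [set a | A a /\ contains_bohr k eta (translate (sumdiff A) (- a))].
split => [a []//||a []//].
rewrite ltNge; apply/negP => /(H G Gc)[a [[Aa notA'] [B [Bbohr Bsub]]]].
apply: notA'; split => //; exists B; split => // g.
move=> /Bsub[x [b [b' [c [[Ab _] [Ab' _] [Ac _] xE]]]] <-].
by exists x => //; exists b, b', c; split.
Qed.
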